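(* For every prime power $q$ there is a constant $C_q$, and there is an absolute constant $c$, such that the following holds. Let $0<\varepsilon<1$, and let $\Phi$ be an instance of CSP$(\mathcal{P})$, where $\mathcal{P}$ is the set of all affine predicates over $\mathbb{F}_q$ (of any arities, which may differ between constraints and may be as large as the number of variables), on $k$ variables $x_1,\dots,x_k$ taking values in $\mathbb{F}_q$, with constraints $C_1,\dots,C_m$. Then $\Phi$ has a $(1\pm\varepsilon)$-sparsifier using at most $C_q\frac{k}{\varepsilon^2}(\log_2(4k/\varepsilon))^{c}$ constraints.
   Context: A predicate $P:\mathbb{F}_q^r\to\{0,1\}$ is affine if there exist $a_0,a_1,\dots,a_r\in\mathbb{F}_q$ such that $P(b_1,\dots,b_r)=0$ if and only if $a_0+\sum_{i=1}^r a_i b_i = 0$ in $\mathbb{F}_q$. An instance of CSP$(\mathcal{P})$ on variables $x_1,\dots,x_k$ is a list of constraints $C_j = P^{(j)}(x_{j,1},\dots,x_{j,r_j})$ with $P^{(j)}\in\mathcal{P}$ of arity $r_j$ applied to a tuple of the variables. For an assignment $x\in\mathbb{F}_q^k$, its value is $\sum_{j=1}^m C_j(x)$. A $(1\pm\varepsilon)$-sparsifier is a subset $T\subseteq[m]$ with nonnegative weights $(w_j)_{j\in T}$ such that for every assignment $x\in\mathbb{F}_q^k$: $(1-\varepsilon)\sum_{j=1}^m C_j(x)\le\sum_{j\in T}w_jC_j(x)\le(1+\varepsilon)\sum_{j=1}^mC_j(x)$. *)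

(* Defs.v *)
From HB Require Import structures.
From mathcomp Require Import all_boot all_order all_algebra all_field.
From mathcomp Require Import Rstruct.
From Stdlib Require Import Reals.
Unset Printing Implicit Defensive.
Import Order.TTheory GRing.Theory Num.Theory.

Local Open Scope ring_scope.

Definition affine_pred (F : fieldType) (r : nat) (P : ('I_r -> F) -> bool) : Prop :=
  exists (a0 : F) (a : 'I_r -> F),
    forall b : 'I_r -> F, (P b = false) <-> (a0 + \sum_(i < r) a i * b i = 0).

Record affine_csp (F : fieldType) (k m : nat) := AffineCSP {
  ar : 'I_m -> nat;
  pr : forall j : 'I_m, ('I_(ar j) -> F) -> bool;
  pr_affine : forall j : 'I_m, @affine_pred F (ar j) (pr j);
  vars : forall j : 'I_m, 'I_(ar j) -> 'I_k
}.

Definition cval (F : fieldType) (k m : nat) (Phi : affine_csp F k m)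
  (j : 'I_m) (x : 'I_k -> F) : R :=
  (pr F k m Phi j (fun i => x (vars F k m Phi j i)) : nat)%:R.

Definition is_sparsifier (F : fieldType) (k m : nat) (Phi : affine_csp F k m)
  (eps : R) (T : {set 'I_m}) (w : 'I_m -> R) : Prop :=
  (forall j, j \in T -> 0 <= w j) /\
  forall x : 'I_k -> F,
    (1 - eps) * (\sum_(j < m) cval F k m Phi j x) <= \sum_(j in T) w j * cval F k m Phi j x /\
    \sum_(j in T) w j * cval F k m Phi j x <= (1 + eps) * (\sum_(j < m) cval F k m Phi j x).

Definition log2 (x : R) : R := (ln x / ln 2)%R.

(* Main.v *)
(* Homogenizing, a constraint becomes a coordinate of a linear code of dimension at most [n = k + 1]
   over F, satisfied exactly when that coordinate of the codeword is nonzero.  As in the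
   Benczur-Karger cut sparsifier, coordinate [j] is kept with probability
   [min 1 (rho * u j)], where [1 / u j] is a strength.  Here the strength is read off the
   principal chain of the support function of subcodes; this gives [\sum_j u j <= n], hence
   about [rho * n] kept coordinates.  On each of the at most [n] strength levels, the
   [u]-weight of the support of a subcode is at least its dimension, so the weighted code
   has at [t = exp (- s)] a weight enumerator at most [(1 + (q - 1) t) ^ n].  Chernoff's
   bound and a union bound over levels and codewords then work with
   [rho] of order [ln (q n) / eps ^ 2], and a codeword's weight is a nonnegative
   combination of its [u]-weights on the levels. *)

Require Import Defs.
From HB Require Import structures.
From mathcomp Require Import all_boot all_order all_algebra all_field.
From mathcomp Require Import Rstruct.
From Stdlib Require Import Reals.
From mathcomp Require Import mxabelem ring lra zify.
Import Order.TTheory GRing.Theory Num.Theory.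
Local Open Scope ring_scope.

(* Otherwise [+] and [*] under a cast to [R] or below [exp] and [ln] are read as Stdlib's
   [Rplus] and [Rmult], which differ syntactically from the ring operations. *)
Bind Scope ring_scope with R.
Local Arguments exp x%_ring_scope.
Local Arguments ln x%_ring_scope.

Set Implicit Arguments.
Unset Strict Implicit.

(** * Exponential inequalities *)

Lemma expRD (x y : R) : exp (x + y) = exp x * exp y.
Proof. exact: exp_plus. Qed.

Lemma expR0 : exp 0 = 1 :> R.
Proof. exact: exp_0. Qed.

Lemma expR_gt0 (x : R) : 0 < exp x.
Proof. by apply/RltP; exact: exp_pos. Qed.

Lemma expR_ge1Dx (x : R) : 1 + x <= exp x.
Proof. by apply/RleP; exact: exp_ineq1_le. Qed.

Lemma ler_expR (x y : R) : x <= y -> exp x <= exp y.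
Proof.
move=> xy; have -> : y = x + (y - x) by ring.
rewrite expRD ler_peMr ?(ltW (expR_gt0 _)) //.
by apply: le_trans (expR_ge1Dx _); lra.
Qed.

Lemma ltr1_expR (x : R) : exp x < 1 -> x < 0.
Proof. by move=> ex1; have := expR_ge1Dx x; lra. Qed.

Lemma expR_sum (I : finType) (P : pred I) (f : I -> R) :
  exp (\sum_(i | P i) f i) = \prod_(i | P i) exp (f i).
Proof. exact: (big_morph exp expRD expR0). Qed.

Lemma expR_pow (x : R) (n : nat) : exp (n%:R * x) = exp x ^+ n.
Proof.
elim: n => [|n IHn]; first by rewrite mul0r expR0 expr0.
by rewrite -natr1 mulrDl mul1r expRD IHn exprSr.
Qed.

Lemma expR_le_quad (t : R) : t <= 1 / 2 -> exp t <= 1 + t + 2 * t ^+ 2.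
Proof.
move=> t12; have inv : exp (- t) * exp t = 1 by rewrite -expRD addNr expR0.
have lb := expR_ge1Dx (- t).
have pos := expR_gt0 t.
have le1 : (1 - t) * exp t <= 1 by have := ler_wpM2r (ltW pos) lb; rewrite inv.
have ge1 : 1 <= (1 - t) * (1 + t + 2 * t ^+ 2).
  have -> : (1 - t) * (1 + t + 2 * t ^+ 2) = 1 + t ^+ 2 * (1 - 2 * t) by ring.
  by rewrite lerDl mulr_ge0 ?sqr_ge0 //; lra.
by rewrite -(@ler_pM2l _ (1 - t)) ?(le_trans le1) //; lra.
Qed.

Lemma expR_le_lin (y : R) : 0 <= y -> y <= 1 / 2 -> exp y <= 1 + 2 * y.
Proof.
move=> y0 y12; apply: le_trans (expR_le_quad y12) _.
have : y * y <= y * (1 / 2) by rewrite ler_wpM2l.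
by rewrite expr2; lra.
Qed.

(** Centering cancels the term linear in [t]: once [exp (- (t * p))] is factored out, the quadratic
    bound on [exp t] leaves [2 * t ^+ 2 * p]. All negative [t] are covered, so both tails are
    served. *)
Lemma bernoulli_mgf_le (t p : R) :
  0 <= p -> t <= 1 / 2 ->
  p * exp (t * (1 - p)) + (1 - p) * exp (- (t * p)) <= exp (2 * t ^+ 2 * p).
Proof.
move=> p0 t12.
have -> : t * (1 - p) = - (t * p) + t by ring.
rewrite expRD.
have -> : p * (exp (- (t * p)) * exp t) + (1 - p) * exp (- (t * p)) =
  exp (- (t * p)) * (1 + p * (exp t - 1)) by ring.
have -> : 2 * t ^+ 2 * p = - (t * p) + p * (t + 2 * t ^+ 2) by ring.
rewrite expRD ler_wpM2l ?(ltW (expR_gt0 _)) //.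
apply: le_trans (expR_ge1Dx _); rewrite lerD2l ler_wpM2l //.
by have := expR_le_quad t12; lra.
Qed.

(** * Derivatives and monotonicity *)

Lemma derivable_pt_lim_sum (I : finType) (P : pred I) (f f' : I -> R -> R) (x : R) :
  (forall i, P i -> derivable_pt_lim (f i) x (f' i x)) ->
  derivable_pt_lim (fun s => \sum_(i | P i) f i s) x (\sum_(i | P i) f' i x).
Proof.
move=> df.
have ext (g h : R -> R) l : g =1 h -> derivable_pt_lim g x l -> derivable_pt_lim h x l.
  move=> gh dg eps /dg[d dP]; exists d => y; rewrite -!gh; exact: dP.
elim: (index_enum I) => [|i r IHr].
  rewrite big_nil; apply: (ext (fct_cte 0)) => [s|]; first by rewrite big_nil.
  exact: derivable_pt_lim_const.
rewrite big_cons; case Pi: (P i); last first.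
  by apply: ext IHr => s; rewrite big_cons Pi.
apply: (ext (plus_fct (f i) (fun s => \sum_(i <- r | P i) f i s))) => [s|].
  by rewrite big_cons Pi.
exact: derivable_pt_lim_plus (df i Pi) IHr.
Qed.

Lemma derivable_pt_lim_exp_scale (a x : R) :
  derivable_pt_lim (fun s => exp (s * a)) x (a * exp (x * a)).
Proof.
have d1 : derivable_pt_lim (fun s => s * a) x a.
  have := derivable_pt_lim_mult id (fct_cte a) x 1 0 (derivable_pt_lim_id x)
    (derivable_pt_lim_const a x).
  by rewrite RmultE RplusE RmultE mulr0 addr0 mul1r.
have := derivable_pt_lim_comp _ _ _ _ _ d1 (derivable_pt_lim_exp (x * a)).
by rewrite RmultE mulrC.
Qed.

Lemma derivable_pt_lim_exp_pow (b x : R) (n : nat) :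
  derivable_pt_lim (fun s => (exp s + b) ^+ n) x (n%:R * (exp x + b) ^+ n.-1 * exp x).
Proof.
have d1 : derivable_pt_lim (fun s => exp s + b) x (exp x).
  have := derivable_pt_lim_plus exp (fct_cte b) x _ _ (derivable_pt_lim_exp x)
    (derivable_pt_lim_const b x).
  by rewrite RplusE addr0.
elim: n => [|n IHn]; first by rewrite !mul0r; exact: (derivable_pt_lim_const 1).
have := derivable_pt_lim_mult _ _ x _ _ d1 IHn.
have -> : (fun s : R => (exp s + b) ^+ n.+1) =
  mult_fct (fun s => exp s + b) (fun s => (exp s + b) ^+ n).
  by apply: FunctionalExtensionality.functional_extensionality => s; rewrite exprS.
congr derivable_pt_lim; rewrite !RplusE !RmultE /= -natr1.
case: n {IHn} => [|n]; first by rewrite !expr0; ring.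
by rewrite /= exprS; ring.
Qed.

Lemma nonpos_derivative_le (f f' : R -> R) (s : R) :
  0 <= s -> (forall x, 0 <= x -> derivable_pt_lim f x (f' x)) ->
  (forall x, 0 <= x -> f' x <= 0) -> f s <= f 0.
Proof.
rewrite le_eqVlt => /predU1P[<- // | s0] df f'0.
have [c [eqf [c0 _]]] := MVT_cor2 f f' 0 s (elimT RltP s0)
  (fun c hc => df c (introT RleP (proj1 hc))).
have f'c := f'0 c (ltW (introT RltP c0)).
rewrite -subr_le0; move: eqf; rewrite !RminusE RmultE subr0 => ->.
by rewrite pmulr_lle0.
Qed.

(** * Supports of subcodes: the rows of [D] are messages, encoded by [A] *)

Definition mxsupp (F : fieldType) (n m p : nat) (A : 'M[F]_(n, m)) (D : 'M[F]_(p, n))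
  : {set 'I_m} := [set j | ~~ (D <= kermx (col j A))%MS].

Lemma mxsupp_row (F : fieldType) (n m : nat) (A : 'M[F]_(n, m)) (x : 'rV[F]_n) (j : 'I_m) :
  (j \in mxsupp A x) = ((x *m A) 0 j != 0).
Proof.
rewrite inE sub_kermx; congr (~~ _); rewrite colE mulmxA -colE.
apply/eqP/eqP => [/matrixP/(_ 0 0)|x0]; first by rewrite [LHS]mxE [RHS]mxE.
by apply/matrixP => i k; rewrite !ord1 [LHS]mxE [RHS]mxE.
Qed.

Lemma mxsuppS (F : fieldType) (n m p1 p2 : nat) (A : 'M[F]_(n, m))
    (D : 'M[F]_(p1, n)) (E : 'M[F]_(p2, n)) :
  (D <= E)%MS -> mxsupp A D \subset mxsupp A E.
Proof. by move=> DE; apply/subsetP => j; rewrite !inE; apply: contra; apply: submx_trans. Qed.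

Lemma mxsuppU (F : fieldType) (n m p1 p2 : nat) (A : 'M[F]_(n, m))
    (D : 'M[F]_(p1, n)) (E : 'M[F]_(p2, n)) :
  mxsupp A (D + E)%MS = mxsupp A D :|: mxsupp A E.
Proof. by apply/setP => j; rewrite !inE addsmx_sub negb_and. Qed.

Lemma mxsupp0 (F : fieldType) (n m p : nat) (A : 'M[F]_(n, m)) :
  mxsupp A (0 : 'M[F]_(p, n)) = set0.
Proof. by apply/setP => j; rewrite !inE sub0mx. Qed.

Lemma mxrank_cap_ker_col (F : fieldType) (n m p : nat) (A : 'M[F]_(n, m))
    (Z : 'M[F]_(p, n)) (j : 'I_m) :
  j \in mxsupp A Z -> \rank Z = (\rank (Z :&: kermx (col j A))%MS).+1.
Proof.
rewrite inE sub_kermx -mxrank_eq0 => nz.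
have := mxrank_mul_ker Z (col j A); have := rank_leq_col (Z *m col j A).
by case: (\rank _) nz => [|[|]].
Qed.

(* Multiplied by [exp (s * \rank Z)], this says that the weight enumerator of the code
   at [t = exp (- s)] is at most [(1 + (q - 1) t) ^ \rank Z], with equality when [v] is
   the indicator of an information set.  Both sides agree at [s = 0]; averaging the
   induction hypothesis over the codes shortened at one coordinate compares the
   derivatives. *)
Lemma weight_enumerator_le (F : finFieldType) (n m : nat) (A : 'M[F]_(n, m))
    (v : 'I_m -> R) (Z : 'M[F]_n) (s : R) :
  (forall j, 0 <= v j) -> 0 <= s ->
  (forall D : 'M[F]_n, (D <= Z)%MS -> (\rank D)%:R <= \sum_(j in mxsupp A D) v j) ->
  \sum_(x : 'rV[F]_n | (x <= Z)%MS)
    exp (s * ((\rank Z)%:R - \sum_(j in mxsupp A x) v j))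
  <= (exp s + (#|F|%:R - 1)) ^+ \rank Z.
Proof.
move=> v0; move: {2}(\rank Z) (erefl (\rank Z)) => r.
elim: r Z s => [|r IHr] Z s rZ s0 hZ; rewrite rZ.
  move/eqP: rZ; rewrite mxrank_eq0 => /eqP ->.
  rewrite (big_pred1 0) => [|x]; last by rewrite submx0.
  by rewrite mxsupp0 big_set0 subrr mulr0 expR0 expr0.
set b : R := #|F|%:R - 1; pose w (x : 'rV[F]_n) : R := \sum_(j in mxsupp A x) v j.
pose f (t : R) : R :=
  \sum_(x : 'rV[F]_n | (x <= Z)%MS) exp (t * (r.+1%:R - w x)) - (exp t + b) ^+ r.+1.
pose f' (t : R) : R :=
  \sum_(x : 'rV[F]_n | (x <= Z)%MS) (r.+1%:R - w x) * exp (t * (r.+1%:R - w x))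
    - r.+1%:R * (exp t + b) ^+ r * exp t.
have df t : derivable_pt_lim f t (f' t).
  apply: derivable_pt_lim_minus; last exact: derivable_pt_lim_exp_pow.
  apply: (derivable_pt_lim_sum (f' := fun x t => (r.+1%:R - w x) * exp (t * (r.+1%:R - w x)))).
  by move=> x _; exact: derivable_pt_lim_exp_scale.
have f0 : f 0 = 0.
  rewrite /f (eq_bigr (fun=> 1)) => [|x _]; last by rewrite mul0r expR0.
  rewrite expR0 (addrC 1) subrK sumr_const -natrX -rZ -card_rowg.
  by apply/eqP; rewrite subr_eq0; apply/eqP; congr (_%:R); apply: eq_card => x; rewrite inE.
suff f'0 t : 0 <= t -> f' t <= 0.
  have := nonpos_derivative_le s0 (fun x _ => df x) f'0.
  by rewrite f0 subr_le0.
(* The exponent uses [r], the rank of the codes shortened at one coordinate; the missing factor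
   [exp t] is restored at the end. *)
move=> t0; pose e (x : 'rV[F]_n) := exp (t * (r%:R - w x)).
pose U : R := \sum_(j in mxsupp A Z) v j; pose B := (exp t + b) ^+ r.
have rU : r.+1%:R <= U by rewrite -rZ; exact: hZ.
(* A codeword of [x] survives shortening at [j] exactly when [j] is off its support, so weighting
   the shortened codes by [v j] counts [x] with weight [U - w x]. *)
have avg : \sum_(x : 'rV[F]_n | (x <= Z)%MS) (U - w x) * e x <= U * B.
  have -> : \sum_(x : 'rV[F]_n | (x <= Z)%MS) (U - w x) * e x =
      \sum_(j in mxsupp A Z) v j *
        \sum_(x : 'rV[F]_n | (x <= Z :&: kermx (col j A))%MS) e x.
    under [RHS]eq_bigr do rewrite big_distrr /=.
    rewrite (exchange_big_dep (fun x : 'rV[F]_n => (x <= Z)%MS)) /=; last first.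
      by move=> j x _; rewrite sub_capmx => /andP[].
    apply: eq_bigr => x xZ; rewrite -big_distrl /=; congr (_ * _).
    rewrite /U /w (big_setID (mxsupp A x)) /= (setIidPr (mxsuppS A xZ)).
    rewrite addrAC subrr add0r.
    apply: eq_bigl => j; rewrite in_setD sub_capmx xZ andbC /=; congr (_ && _).
    by rewrite inE negbK.
  rewrite /U big_distrl; apply: ler_sum => j jZ; rewrite ler_wpM2l //.
  have rK : \rank (Z :&: kermx (col j A))%MS = r.
    by have := mxrank_cap_ker_col jZ; rewrite rZ => -[].
  have := IHr (Z :&: kermx (col j A))%MS t rK t0; rewrite rK; apply => D DK.
  by apply: hZ; apply: submx_trans DK (capmxSl _ _).
have e0 x : 0 < e x by exact: expR_gt0.
have w0 x : 0 <= w x by apply: sumr_ge0.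
pose X := \sum_(x : 'rV[F]_n | (x <= Z)%MS) w x * e x.
pose Y := \sum_(x : 'rV[F]_n | (x <= Z)%MS) e x.
have split c : \sum_(x : 'rV[F]_n | (x <= Z)%MS) (c - w x) * e x = c * Y - X.
  by rewrite /X /Y big_distrr -sumrB; apply: eq_bigr => x _; rewrite mulrBl.
have X0 : 0 <= X by apply: sumr_ge0 => x _; rewrite mulr_ge0 // ltW.
(* [avg] reads [U * (Y - B) <= X]. If [Y <= B], use [0 <= X]; otherwise [U] may be lowered to
   [r.+1]. *)
have main : r.+1%:R * Y - X <= r.+1%:R * B.
  move: avg; rewrite split => avg; have [YB|BY] := lerP Y B.
    have : r.+1%:R * Y <= r.+1%:R * B by rewrite ler_wpM2l.
    by lra.
  have : r.+1%:R * (Y - B) <= U * (Y - B) by rewrite ler_wpM2r // subr_ge0 ltW.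
  by lra.
have -> : f' t = (r.+1%:R * Y - X - r.+1%:R * B) * exp t.
  rewrite mulrBl -split big_distrl /=; congr (_ - _).
  apply: eq_bigr => x _; rewrite -mulrA -expRD; congr (_ * exp _).
  by rewrite -natr1; ring.
by rewrite pmulr_lle0 ?expR_gt0 // subr_le0.
Qed.

(** * Strengths and the principal chain *)

Lemma sum_setD_cut (T : finType) (f : T -> R) (G D W : {set T}) :
  W \subset D ->
  \sum_(j in G :\: W) f j = \sum_(j in (G :&: D) :\: W) f j + \sum_(j in G :\: D) f j.
Proof.
move=> WD; rewrite (big_setID D) setIDAC /=; congr (_ + _).
by rewrite setDDl (setUidPr WD).
Qed.

Lemma card_sum1 (T : finType) (S : {set T}) : #|S|%:R = \sum_(j in S) (1 : R).
Proof. by rewrite sumr_const. Qed.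

(** The left side is the dimension of [G] modulo [W]. For [G] meeting [W] trivially this is the
    hypothesis of [weight_enumerator_le]; allowing every [G] lets the bounds of successive links be
    added. *)
Definition dominates_rank (F : fieldType) (n m : nat) (A : 'M[F]_(n, m)) (u : 'I_m -> R)
    (W : 'M[F]_n) : Prop :=
  forall G : 'M[F]_n,
    (\rank G)%:R - (\rank (G :&: W)%MS)%:R <= \sum_(j in mxsupp A G :\: mxsupp A W) u j.

(* The convex-hull chain of the points [(\rank D, #|mxsupp A D|)]: each link [W < D]
   minimizes the slope [k = #|mxsupp A D :\: mxsupp A W| / (\rank D - \rank W)], and
   [(u j)^-1] is the slope of the link whose support first contains [j].  Slopes increase
   along the chain; the list [s] carries the spaces with their slope increments, [k0] being
   the slope reached before [W]. *)
Lemma strength_decomposition (F : finFieldType) (n m : nat) (A : 'M[F]_(n, m))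
    (W : 'M[F]_n) (k0 : R) :
  (forall D : 'M[F]_n, (W < D)%MS -> (0 < #|mxsupp A D :\: mxsupp A W|)%nat) ->
  (forall D : 'M[F]_n, (W <= D)%MS ->
    k0 * ((\rank D)%:R - (\rank W)%:R) <= #|mxsupp A D :\: mxsupp A W|%:R) ->
  exists (s : seq ('M[F]_n * R)) (u : 'I_m -> R),
  [/\ (size s <= n - \rank W)%nat,
      forall j, 0 <= u j,
      \sum_(j in ~: mxsupp A W) u j <= n%:R - (\rank W)%:R,
      forall p, p \in (W, 0) :: s -> [/\ (W <= p.1)%MS, 0 <= p.2 & dominates_rank A u p.1]
    & forall j, j \in mxsupp A (1%:M : 'M_n) :\: mxsupp A W ->
        0 < u j /\ \sum_(p <- s) p.2 * (j \notin mxsupp A p.1)%:R = (u j)^-1 - k0].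
Proof.
have [r] := ubnP (n - \rank W); elim: r W k0 => // r IHr W k0 /ltnSE ler hpos hk0.
have [fullW | nfullW] := boolP (row_full W).
  exists [::], (fun=> 0); split=> // [| p | j].
  - by rewrite big1 // subr_ge0 ler_nat rank_leq_col.
  - rewrite inE => /eqP-> /=; split=> // G.
    rewrite big1 // subr_le0 ler_nat mxrankS // sub_capmx submx_refl.
    exact: submx_full.
  - by rewrite inE => /andP[/negP jW /(subsetP (mxsuppS A (submx_full _ fullW)))].
have ltW1 : (W < (1%:M : 'M_n))%MS by rewrite ltmx1.
pose gap (D : 'M[F]_n) : R := (\rank D)%:R - (\rank W)%:R.
pose new (D : 'M[F]_n) : R := #|mxsupp A D :\: mxsupp A W|%:R.
have gap0 (D : 'M[F]_n) : (W < D)%MS -> 0 < gap D.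
  by move=> WD; rewrite subr_gt0 ltr_nat rank_ltmx.
pose D := [arg min_(D < (1%:M : 'M[F]_n) | (W < D)%MS) (new D / gap D)]%O.
have [WD Dmin] : (W < D)%MS /\ forall E : 'M[F]_n, (W < E)%MS ->
    new D / gap D <= new E / gap E.
  by rewrite /D; case: arg_minP.
pose k : R := new D / gap D.
have k_gt0 : 0 < k by rewrite divr_gt0 ?gap0 // ltr0n hpos.
have newD : new D = k * gap D by rewrite divfK // gt_eqF // gap0.
have min_new (E : 'M[F]_n) : (W <= E)%MS -> k * gap E <= new E.
  move=> WE; have [EW|nEW] := boolP (E <= W)%MS.
    have -> : gap E = 0.
      by apply/eqP; rewrite subr_eq0 eqr_nat eqn_leq !mxrankS.
    by rewrite mulr0 ler0n.
  have ltWE : (W < E)%MS by rewrite ltmxE WE.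
  by rewrite -ler_pdivlMr ?gap0 // Dmin.
have leWD : (W <= D)%MS := ltmxW WD.
have sWD := mxsuppS A leWD.
have newE (E : 'M[F]_n) : (D <= E)%MS ->
    new E = new D + #|mxsupp A E :\: mxsupp A D|%:R.
  move=> DE; rewrite /new !card_sum1 (sum_setD_cut _ _ sWD).
  by rewrite (setIidPr (mxsuppS A DE)).
(* Subtracting the equality at [D] from the minimality of [k] shows that later slopes are at least
   [k]. *)
have hk (E : 'M[F]_n) : (D <= E)%MS ->
    k * ((\rank E)%:R - (\rank D)%:R) <= #|mxsupp A E :\: mxsupp A D|%:R.
  move=> DE; have := min_new E (submx_trans leWD DE).
  by rewrite newE // newD /gap; lra.
have rWD := rank_ltmx WD.
have [| E DE | // | s' [u' [szs' u'0 sumu' doms' levels']]] := IHr D k.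
- have := rank_leq_col D; have := rank_leq_col W.
  by move: rWD ler; lia.
- rewrite -(ltr_nat R); apply: lt_le_trans (hk E (ltmxW DE)).
  by rewrite mulr_gt0 // subr_gt0 ltr_nat rank_ltmx.
(* With weight [k^-1] on the coordinates new in [D], this link adds exactly [gap D] to the total
   weight. *)
pose u j := if j \in mxsupp A D then k^-1 else u' j.
have uD j : j \in mxsupp A D -> u j = k^-1 by rewrite /u => ->.
have uND j : j \notin mxsupp A D -> u j = u' j by rewrite /u => /negPf->.
have sum_uD (S : {set 'I_m}) : \sum_(j in (S :&: mxsupp A D) :\: mxsupp A W) u j =
    k^-1 * #|(S :&: mxsupp A D) :\: mxsupp A W|%:R.
  rewrite card_sum1 big_distrr /=; apply: eq_bigr => j.
  by rewrite !inE mulr1 => /and3P[_ _ jD]; rewrite uD // inE.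
have sum_uND (S V : {set 'I_m}) : mxsupp A D \subset V ->
    \sum_(j in S :\: V) u j = \sum_(j in S :\: V) u' j.
  move=> DV; apply: eq_bigr => j; rewrite inE => /andP[jV _].
  by rewrite uND //; apply: contra jV; apply: (subsetP DV).
(* Off [mxsupp A D], induction pays for [G] modulo [G :&: D]; on it, minimality at [(G :&: D) + W]
   pays for [G :&: D] modulo [W]. *)
have domW : dominates_rank A u W.
  move=> G; rewrite (sum_setD_cut _ _ sWD) sum_uD sum_uND //.
  pose M := (G :&: D)%MS; have [_ _ /(_ G)] := doms' _ (mem_head _ _); rewrite -/M => domG.
  have capMW : \rank (M :&: W)%MS = \rank (G :&: W)%MS.
    apply/eqP; rewrite eqn_leq !mxrankS // !sub_capmx.
      by rewrite capmxSl capmxSr (submx_trans (capmxSr _ _) leWD).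
    by rewrite capmxSr (submx_trans (capmxSl _ _) (capmxSl _ _)).
  have gapM : gap (M + W)%MS = (\rank M)%:R - (\rank (G :&: W)%MS)%:R.
    have := mxrank_sum_cap M W; rewrite /gap capMW => /(congr1 (fun i => i%:R : R)).
    by rewrite !natrD; lra.
  have := min_new (M + W)%MS (addsmxSr _ _).
  rewrite gapM -ler_pdivlMl // => newM.
  have : k^-1 * new (M + W)%MS <=
      k^-1 * #|(mxsupp A G :&: mxsupp A D) :\: mxsupp A W|%:R.
    rewrite ler_wpM2l ?invr_ge0 ?(ltW k_gt0) // ler_nat subset_leq_card //.
    rewrite mxsuppU setDUl setDv setU0 setSD // subsetI.
    by rewrite !mxsuppS ?capmxSl ?capmxSr.
  by lra.
(* The increments telescope: if [j] is new in [D], only the entry of [W] misses it, giving [k - k0];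
   otherwise that is added to [(u j)^-1 - k]. *)
exists ((W, k - k0) :: s'), u; split.
- by move: szs' rWD (rank_leq_col D) => /=; lia.
- by move=> j; rewrite /u; case: ifP => _ //; rewrite invr_ge0 ltW.
- rewrite -setTD (sum_setD_cut _ _ sWD) sum_uD sum_uND // setTI setTD.
  rewrite -/(new D) newD mulKf ?gt_eqF // /gap; move: sumu'; lra.
- move=> p; rewrite !inE => /or3P[/eqP-> // | /eqP-> | ps'].
    split=> //=; have := hk0 D leWD; rewrite -/(new D) -/(gap D) newD.
    by rewrite ler_pM2r ?gap0 // subr_ge0.
  have [|Dp p0 domp] := doms' p; first by rewrite inE ps' orbT.
  split=> //; first exact: submx_trans leWD Dp.
  by move=> G; rewrite sum_uND ?mxsuppS.
- move=> j; rewrite in_setD => /andP[jW j1]; rewrite big_cons /= jW mulr1.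
  have [jD|jD] := boolP (j \in mxsupp A D).
    rewrite uD // invr_gt0 invrK; split=> //.
    rewrite big1_seq ?addr0 // => p /andP[_ ps'].
    have [|Dp _ _] := doms' p; first by rewrite inE ps' orbT.
    by rewrite (subsetP (mxsuppS A Dp)) // mulr0.
  have [|u'j ->] := levels' j; first by rewrite in_setD jD.
  by rewrite uND //; split=> //; lra.
Qed.

(** * Random sampling and Chernoff bounds *)

Lemma exists_set_of_mgf (m : nat) (p : 'I_m -> R) (a : R) (E : finType) (P : pred E)
    (h : E -> 'I_m -> bool -> R) (b : E -> R) :
  (forall j, 0 <= p j <= 1) -> \sum_j p j <= a ->
  \sum_(e | P e) exp (- b e) *
    \prod_j (p j * exp (h e j true) + (1 - p j) * exp (h e j false)) <= 1 / 2 ->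
  exists T : {set 'I_m}, #|T|%:R <= 2 * a + 2 /\
    forall e, P e -> \sum_j h e j (j \in T) <= b e.
Proof.
move=> p01 pa hE.
(* The law of a set containing each [j] independently with probability [p j]. *)
pose pr (T : {set 'I_m}) := \prod_j (if j \in T then p j else 1 - p j).
have pr0 T : 0 <= pr T.
  by apply: prodr_ge0 => j _; case: ifP => _; have := p01 j; lra.
have mean f : \sum_T pr T * \prod_j f j (j \in T) =
    \prod_j (p j * f j true + (1 - p j) * f j false) :> R.
  rewrite bigA_distr; apply: eq_bigr => T _; rewrite -big_split /=.
  by apply: eq_bigr => j _; case: (j \in T).
have pr1 : \sum_T pr T = 1.
  have := mean (fun _ _ => 1); rewrite [RHS]big1 => [<-|j _]; last by ring.
  by apply: eq_bigr => T _; rewrite big1 ?mulr1.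
(* A term exceeds 1 when its bound fails. The means add up to less than 1, so some [T] keeps every
   term below 1. For the size, [exp 1 <= 3] bounds the mean by [exp (-2)]. *)
pose size_term (T : {set 'I_m}) := exp (- (2 * a + 2)) * \prod_j exp ((j \in T)%:R).
pose event_term (T : {set 'I_m}) e := exp (- b e) * \prod_j exp (h e j (j \in T)).
have mean_size : \sum_T pr T * size_term T < 1 / 2.
  under eq_bigr do rewrite mulrCA.
  rewrite -big_distrr /= (mean (fun _ c => exp c%:R)).
  apply: (@le_lt_trans _ _ (exp (-2))).
    have -> : -2 = - (2 * a + 2) + 2 * a :> R by ring.
    rewrite expRD ler_wpM2l ?(ltW (expR_gt0 _)) //.
    apply: (@le_trans _ _ (exp (\sum_j 2 * p j))); last first.
      by rewrite ler_expR // -big_distrr ler_wpM2l.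
    rewrite expR_sum; apply: ler_prod => j _; have /andP[pj0 pj1] := p01 j.
    have e1 : exp 1 <= 3 by rewrite -INRE INR_IZR_INZ; apply/RleP; exact: exp_le_3.
    rewrite expR0 mulr1; apply/andP; split.
      by rewrite addr_ge0 ?subr_ge0 // mulr_ge0 // ltW ?expR_gt0.
    apply: le_trans (expR_ge1Dx _).
    have : p j * exp 1 <= p j * 3 by rewrite ler_wpM2l.
    by lra.
  have inv : exp (-2) * exp 2 = 1 by rewrite -expRD addNr expR0.
  have e0 : 0 < exp (-2) by exact: expR_gt0.
  have e2 : 1 + 2 <= exp 2 by exact: expR_ge1Dx.
  have : exp (-2) * 3 <= exp (-2) * exp 2 by rewrite ler_wpM2l ?(ltW e0) //; lra.
  by rewrite inv; lra.
have mean_event : \sum_T pr T * \sum_(e | P e) event_term T e <= 1 / 2.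
  under eq_bigr do rewrite big_distrr /=.
  rewrite exchange_big /=; apply: le_trans hE; apply: ler_sum => e _.
  under eq_bigr do rewrite mulrCA.
  by rewrite -big_distrr /= (mean (fun j c => exp (h e j c))).
have [T ltT] : exists T, size_term T + \sum_(e | P e) event_term T e < 1.
  apply/existsP; apply: contraT; rewrite negb_exists => /forallP nT; exfalso.
  have : 1 <= \sum_T pr T * (size_term T + \sum_(e | P e) event_term T e).
    rewrite -{1}pr1; apply: ler_sum => T _.
    by rewrite ler_peMr // leNgt nT.
  under eq_bigr do rewrite mulrDr.
  by rewrite big_split /=; lra.
have size0 : 0 <= size_term T.
  by rewrite mulr_ge0 ?prodr_ge0 // => *; rewrite ltW ?expR_gt0.
have event0 e : 0 <= event_term T e.
  by rewrite mulr_ge0 ?prodr_ge0 // => *; rewrite ltW ?expR_gt0.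
exists T; split=> [|e Pe].
  have : size_term T < 1.
    by apply: le_lt_trans ltT; rewrite lerDl sumr_ge0.
  rewrite /size_term -expR_sum -expRD => /ltr1_expR.
  have -> : \sum_j (j \in T)%:R = #|T|%:R :> R.
    by rewrite card_sum1 [RHS]big_mkcond; apply: eq_bigr => j _; case: (j \in T).
  by lra.
have : event_term T e < 1.
  apply: le_lt_trans ltT; rewrite (bigD1 e) //=.
  have : 0 <= \sum_(i | P i && (i != e)) event_term T i by apply: sumr_ge0.
  by lra.
by rewrite /event_term -expR_sum -expRD => /ltr1_expR; lra.
Qed.

(** Divide the weight enumerator bound by [exp (s * \rank Z)] and remove the zero message, whose
    term is 1. The rest is at most [exp y - 1 <= 2 * y] for [y = n%:R * #|F|%:R * exp (- s)]. *)
Lemma weight_enumerator_tail (F : finFieldType) (n m : nat) (A : 'M[F]_(n, m))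
    (v : 'I_m -> R) (Z : 'M[F]_n) (s : R) :
  (forall j, 0 <= v j) -> 0 <= s ->
  (forall D : 'M[F]_n, (D <= Z)%MS -> (\rank D)%:R <= \sum_(j in mxsupp A D) v j) ->
  n%:R * #|F|%:R * exp (- s) <= 1 / 2 ->
  \sum_(x : 'rV[F]_n | (x <= Z)%MS && (x != 0)) exp (- (s * \sum_(j in mxsupp A x) v j))
  <= 2 * (n%:R * #|F|%:R * exp (- s)).
Proof.
move=> v0 s0 hZ small; have := weight_enumerator_le v0 s0 hZ.
set r := \rank Z; have inv : exp (- s) * exp s = 1 by rewrite -expRD addNr expR0.
have e0 := expR_gt0 (- s).
rewrite -(@ler_pM2l _ (exp (- s) ^+ r)) ?exprn_gt0 //.
rewrite -exprMn mulrDr inv big_distrr /=.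
under eq_bigr => x _.
  rewrite -expR_pow -expRD.
  have -> : r%:R * - s + s * (r%:R - \sum_(j in mxsupp A x) v j) =
    - (s * \sum_(j in mxsupp A x) v j) by ring.
  over.
rewrite (bigD1 0) ?sub0mx //= mxsupp0 big_set0 mulr0 oppr0 expR0.
set S := \sum_(i | _) _ => le_pow.
suff : (1 + exp (- s) * (#|F|%:R - 1)) ^+ r <= exp (n%:R * #|F|%:R * exp (- s)).
  have y0 : 0 <= n%:R * #|F|%:R * exp (- s) by rewrite mulr_ge0 ?mulr_ge0 ?ler0n // ltW.
  have := expR_le_lin y0 small; lra.
have q1 : 1 <= #|F|%:R :> R by rewrite ler1n; apply/card_gt0P; exists 0.
apply: (@le_trans _ _ (exp (exp (- s) * #|F|%:R) ^+ r)).
  rewrite lerXn2r ?nnegrE ?(ltW (expR_gt0 _)) //.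
    by rewrite addr_ge0 // mulr_ge0 ?subr_ge0 // ltW.
  apply: le_trans (expR_ge1Dx _); lra.
rewrite -expR_pow ler_expR // -mulrA (mulrC _ (exp _)) ler_wpM2r ?ler_nat ?rank_leq_row //.
by rewrite mulr_ge0 ?ler0n // ltW.
Qed.

Lemma code_sparsifier (F : finFieldType) (n m : nat) (A : 'M[F]_(n, m)) (eps : R) :
  0 < eps -> eps < 1 -> (1 < n)%nat ->
  exists (T : {set 'I_m}) (w : 'I_m -> R),
  [/\ forall j, 0 <= w j,
      forall x : 'rV[F]_n,
        `|\sum_(j in mxsupp A x) ((if j \in T then w j else 0) - 1)| <= eps * #|mxsupp A x|%:R
    & #|T|%:R <= 48 * (n%:R * ln (#|F|%:R * n%:R) / eps ^+ 2) + 2].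
Proof.
(* Starting the chain at the kernel makes every strictly larger space gain a coordinate, whatever
   the rank of [A]. *)
move=> eps0 eps1 n1; pose W0 := kermx A; pose q : R := #|F|%:R.
have suppW0 : mxsupp A W0 = set0.
  by apply/setP => j; rewrite !inE sub_kermx colE mulmxA mulmx_ker mul0mx eqxx.
have [||s [u [szs u0 sumu doms levels]]] := @strength_decomposition F n m A W0 0.
- move=> D; rewrite ltmxE suppW0 setD0 => /andP[_ nD]; rewrite card_gt0.
  apply: contra nD => /eqP/setP nD; apply/sub_kermxP/matrixP => i j.
  have := nD j; rewrite !inE sub_kermx => /negbFE/eqP/matrixP/(_ i 0).
  by rewrite colE mulmxA -colE !mxE.
- by move=> D _; rewrite mul0r ler0n.
have {}sumu : \sum_j u j <= n%:R.
  apply: le_trans (_ : n%:R - (\rank W0)%:R <= _); last by rewrite gerBl ler0n.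
  apply: le_trans sumu; rewrite suppW0 setC0.
  by rewrite [leRHS](eq_bigl xpredT) // => j; rewrite inE.
have {}szs : (size s <= n)%nat by apply: leq_trans szs (leq_subr _ _).
have q2 : 2 <= q by rewrite ler_nat (cardD1 0) (cardD1 1) !inE oner_neq0.
have n2 : 2 <= n%:R :> R by rewrite ler_nat.
pose L := ln (q * n%:R).
have qn4 : 4 <= q * n%:R.
  by have -> : 4 = 2 * 2 :> R; [ring | rewrite ler_pM ?ler0n].
have expL : exp L = q * n%:R by apply: exp_ln; apply/RltP; rewrite R0E; lra.
have L0 : 0 < L.
  by rewrite ltNge; apply/negP => /ler_expR; rewrite expL expR0; lra.
pose rho := 24 * L / eps ^+ 2.
have rho0 : 0 < rho by rewrite divr_gt0 ?exprn_gt0 ?mulr_gt0.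
pose a j := rho * u j.
have a0 j : 0 <= a j by rewrite mulr_ge0 // ltW.
(* [p j * w j = 1] unless [a j = 0], and then [dev] vanishes; so [dev] always has mean zero. *)
pose w j : R := if 1 <= a j then 1 else (a j)^-1.
pose p j : R := Num.min 1 (a j).
pose dev j (c : bool) : R := a j * ((if c then w j else 0) - 1).
have w0 j : 0 <= w j by rewrite /w; case: ifP => _ //; rewrite invr_ge0.
have mgf t j : t <= 1 / 2 ->
    p j * exp (t * dev j true) + (1 - p j) * exp (t * dev j false) <=
    exp (2 * t ^+ 2 * a j).
  move=> t12; rewrite /dev /w /p /=; case: (leP 1 (a j)) => [_ | a1] /=.
        rewrite !subrr !mulr0 expR0 mul0r addr0 mulr1.
    apply: le_trans (expR_ge1Dx _); rewrite lerDl.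
    by rewrite mulr_ge0 // mulr_ge0 ?sqr_ge0.
  have [->|nz] := eqVneq (a j) 0.
    by rewrite !(mul0r, mulr0) expR0 subr0 mulr1 add0r.
  have := bernoulli_mgf_le (a0 j) t12.
  by rewrite sub0r mulrN1 mulrN [a j * (_ - 1)]mulrBr mulfV // mulr1.
pose V (i : 'I_(size s)) := (nth (W0, 0) s i).1.
have memV (i : 'I_(size s)) : nth (W0, 0) s i \in (W0, 0) :: s.
  by rewrite inE mem_nth ?orbT.
pose S (i : 'I_(size s)) (x : 'rV[F]_n) := mxsupp A x :\: mxsupp A (V i).
(* An event is a choice of tail, a level and a nonzero message in a complement of [V i], since off
   the support of [V i] only the message modulo [V i] matters. *)
pose P (e : bool * 'I_(size s) * 'rV[F]_n) :=
  (e.2 <= (V e.1.2)^C)%MS && (e.2 != 0).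
pose t (e : bool * 'I_(size s) * 'rV[F]_n) : R := (-1) ^+ e.1.1 * (eps / 4).
pose h (e : bool * 'I_(size s) * 'rV[F]_n) j (c : bool) : R :=
  if j \in S e.1.2 e.2 then t e * dev j c else 0.
pose b (e : bool * 'I_(size s) * 'rV[F]_n) : R :=
  eps / 4 * (eps * \sum_(j in S e.1.2 e.2) a j).
(* Per unit of [u]-weight the exponent is [(eps ^+ 2 / 4 - 2 * (eps / 4) ^+ 2) * rho = 3 * L], which
   fixes the 24 in [rho]. *)
have term_le e : exp (- b e) *
    \prod_j (p j * exp (h e j true) + (1 - p j) * exp (h e j false)) <=
    exp (- (3 * L * \sum_(j in S e.1.2 e.2) u j)).
  have t2 : t e ^+ 2 = (eps / 4) ^+ 2.
    by rewrite exprMn -exprM mulnC exprM sqrrN expr1n expr1n mul1r.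
  have t12 : t e <= 1 / 2.
    by rewrite /t; case: e.1.1; rewrite ?expr1 ?expr0; lra.
  have -> : - (3 * L * \sum_(j in S e.1.2 e.2) u j) =
      - b e + \sum_(j in S e.1.2 e.2) 2 * t e ^+ 2 * a j.
    rewrite -big_distrr /= t2 /b /a -big_distrr /= /rho.
    by field; rewrite gt_eqF.
  rewrite expRD ler_wpM2l ?(ltW (expR_gt0 _)) // expR_sum [leRHS]big_mkcond /=.
  apply: ler_prod => j _; apply/andP; split.
    rewrite addr_ge0 // mulr_ge0 ?(ltW (expR_gt0 _)) //.
      by rewrite le_min ler01 a0.
    by rewrite subr_ge0 ge_min lexx.
  rewrite /h; case: ifP => _; first exact: mgf.
  by rewrite expR0; lra.
have [||| T [cardT devT]] := @exists_set_of_mgf m p (rho * n%:R) _ P h b.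
- by move=> j; rewrite le_min ler01 a0 ge_min lexx.
- apply: (@le_trans _ _ (\sum_j a j)).
    by apply: ler_sum => j _; rewrite ge_min lexx orbT.
  by rewrite -big_distrr ler_wpM2l // ltW.
(* Here [y] is the inverse of [(q * n%:R) ^+ 2]; two tails on at most [n] levels, each costing
   [2 * y], total at most [4 * n%:R * y <= 1 / 2]. *)
- pose y := n%:R * q * exp (- (3 * L)).
  have inv : exp (- (3 * L)) * (q * n%:R) ^+ 3 = 1.
    by rewrite -expL -expR_pow -expRD addNr expR0.
  have y_small : n%:R * y <= 1 / 8.
    have e0 := expR_gt0 (- (3 * L)).
    have -> : n%:R * y = exp (- (3 * L)) * (q * n%:R) ^+ 3 / (q * (q * n%:R)).
      by rewrite /y; field; rewrite !gt_eqF //; lra.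
    rewrite inv ler_pdivrMr; last by rewrite mulr_gt0; lra.
    have : 2 * 4 <= q * (q * n%:R) by rewrite ler_pM //; lra.
    by lra.
  have y0 : 0 <= y by rewrite !mulr_ge0 ?ler0n ?(ltW (expR_gt0 _)) //; lra.
  have y_half : y <= 1 / 2.
    have : 2 * y <= n%:R * y by rewrite ler_wpM2r.
    lra.
  apply: (@le_trans _ _ (\sum_(e | P e) exp (- (3 * L * \sum_(j in S e.1.2 e.2) u j)))).
    by apply: ler_sum => e _; exact: term_le.
  have tail (i : 'I_(size s)) :
      \sum_(x : 'rV[F]_n | (x <= (V i)^C)%MS && (x != 0))
        exp (- (3 * L * \sum_(j in S i x) u j)) <= 2 * y.
    have [_ _ dom] := doms _ (memV i).
    (* Zeroing [u] on the support of [V i] turns [dominates_rank] on a complement into the rank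
       hypothesis of the tail bound. *)
    pose v j := if j \in mxsupp A (V i) then 0 else u j.
    have sumv (G : {set 'I_m}) : \sum_(j in G :\: mxsupp A (V i)) u j = \sum_(j in G) v j.
      rewrite [RHS](big_setID (mxsupp A (V i))) /= [X in _ = X + _]big1 ?add0r.
        by apply: eq_bigr => j; rewrite inE /v => /andP[/negPf->].
      by move=> j; rewrite inE /v => /andP[_ ->].
    under eq_bigr do rewrite sumv.
    apply: weight_enumerator_tail => //.
    - by move=> j; rewrite /v; case: ifP.
    - by rewrite mulr_ge0 // ltW.
    move=> D DV; have := dom D; rewrite sumv.
    suff -> : \rank (D :&: (nth (W0, 0%R) s i).1)%MS = 0%nat by rewrite subr0.
    apply/eqP; rewrite mxrank_eq0 -submx0 -(capmx_compl (V i)) sub_capmx.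
    by rewrite capmxSr (submx_trans (capmxSl _ _) DV).
  rewrite -(pair_big_dep xpredT (fun i x => (x <= (V i.2)^C)%MS && (x != 0))
    (fun i x => exp (- (3 * L * \sum_(j in S i.2 x) u j)))) /=.
  apply: (@le_trans _ _ (\sum_(i : bool * 'I_(size s)) 2 * y)).
    by apply: ler_sum => i _; exact: tail.
  rewrite sumr_const card_prod card_bool card_ord -[leLHS]mulr_natl natrM.
  have : (size s)%:R * y <= n%:R * y by rewrite ler_wpM2r ?ler_nat.
  by lra.
exists T, w; split=> // [x|]; last first.
  apply: le_trans cardT _; rewrite -/q -/L lerD2r le_eqVlt; apply/orP; left.
  by apply/eqP; rewrite /rho; field; rewrite gt_eqF.
have level_dev (i : 'I_(size s)) :
    `|\sum_(j in S i x) dev j (j \in T)| <= eps * \sum_(j in S i x) a j.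
  (* Dropping the component of [x] in [V i] leaves its support off [mxsupp A (V i)] unchanged. *)
  have [[y z] /= xyz] := sub_addsmxP (submx_full x (addsmx_compl_full (V i))).
  pose x' := z *m (V i)^C%MS.
  have -> : S i x = S i x'.
    apply/setP => j; rewrite !in_setD; case: (boolP (j \in _)) => //= jV.
    rewrite !mxsupp_row; congr (_ != 0).
    rewrite xyz mulmxDl mxE [X in X + _](_ : _ = 0) ?add0r //.
    apply/eqP; rewrite -[_ == 0]negbK -mxsupp_row; apply: contra jV.
    by apply: subsetP; apply: mxsuppS; exact: submxMl.
  have [x'0|x'0] := eqVneq x' 0.
    by rewrite /S x'0 mxsupp0 set0D !big_set0 normr0 mulr0.
  have dev_le c : (-1) ^+ (c : bool) * \sum_(j in S i x') dev j (j \in T) <=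
      eps * \sum_(j in S i x') a j.
    have /devT : P (c, i, x') by rewrite /P /= submxMl x'0.
    rewrite /b /h -big_mkcond -big_distrr /= /t mulrAC mulrC.
    by rewrite ler_pM2l //; lra.
  rewrite ler_norml; have := dev_le true; have := dev_le false.
  by rewrite expr1 expr0 mul1r mulN1r => d1 d2; apply/andP; split; lra.
(* The increments of the levels missing [j] sum to [(u j)^-1], so each [f j] is recovered from its
   [u]-weighted copies. *)
have levels_sum (f : 'I_m -> R) : \sum_(j in mxsupp A x) f j =
    \sum_(i < size s) (nth (W0, 0) s i).2 * \sum_(j in S i x) u j * f j.
  under [RHS]eq_bigr do rewrite big_distrr /=.
  rewrite (exchange_big_dep (fun j => j \in mxsupp A x)) /=; last first.
    by move=> i j _; rewrite inE => /andP[].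
  apply: eq_bigr => j jx.
  have [|uj] := levels j.
    by rewrite suppW0 setD0; apply: subsetP jx; apply: mxsuppS; exact: submx1.
  rewrite subr0 (big_nth (W0, 0)) big_mkord => eqj.
  rewrite -[LHS](mulKf (lt0r_neq0 uj)) -eqj big_distrl [RHS]big_mkcond /=.
  apply: eq_bigr => i _; rewrite in_setD jx andbT.
  by case: (j \notin _) => /=; rewrite ?mulr1n ?mulr1 ?mulr0n ?mulr0 ?mul0r.
rewrite card_sum1 !levels_sum big_distrr /=.
apply: le_trans (ler_norm_sum _ _ _) _; apply: ler_sum => i _.
have [_ d0 _] := doms _ (memV i).
rewrite normrM ger0_norm // mulrCA ler_wpM2l //.
rewrite -(@ler_pM2l _ rho) // -[X in X * _ <= _]gtr0_norm // -normrM mulrCA.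
have -> : rho * \sum_(j in S i x) u j * ((if j \in T then w j else 0) - 1) =
    \sum_(j in S i x) dev j (j \in T).
  by rewrite big_distrr /=; apply: eq_bigr => j _; rewrite mulrA.
have -> : rho * \sum_(j in S i x) u j * 1 = \sum_(j in S i x) a j.
  by rewrite big_distrr /=; apply: eq_bigr => j _; rewrite mulr1.
exact: level_dev.
Qed.

(** * From affine constraints to codes *)

Lemma affine_pred_column (F : fieldType) (k r : nat) (P : ('I_r -> F) -> bool)
    (vs : 'I_r -> 'I_k) :
  affine_pred F r P ->
  exists c : 'cV[F]_(1 + k), forall x : 'I_k -> F,
    P (fun i => x (vs i)) = ((row_mx (1%:M : 'M_1) (\row_v x v) *m c) 0 0 != 0).
Proof.
move=> [a0 [a aP]].
(* The top entry pairs with the leading 1 of the message; a variable filling several positions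
   receives the sum of their coefficients. *)
exists (col_mx (a0%:M : 'M_1) (\col_v \sum_(i < r | vs i == v) a i)) => x.
have -> : (row_mx (1%:M : 'M_1) (\row_v x v) *m
    col_mx (a0%:M : 'M_1) (\col_v \sum_(i < r | vs i == v) a i)) 0 0 =
    a0 + \sum_(i < r) a i * x (vs i).
  rewrite mul_row_col mul1mx [LHS]mxE [X in X + _]mxE eqxx mulr1n; congr (_ + _).
  rewrite mxE (partition_big vs xpredT) //=; apply: eq_bigr => v _.
  by rewrite !mxE big_distrr /=; apply: eq_bigr => i /eqP <-; rewrite mulrC.
apply/idP/idP => [Px|]; last by apply: contraR => /negbTE/aP ->.
by apply/eqP => /aP; rewrite Px.
Qed.

(** [4 * k / eps] is at least both 2 and [1 + k], and [ln 2 <= 1]; the term [ln q <= q - 1] is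
    absorbed because the logarithm is at least 1. *)
Lemma ln_code_length_le (q k eps : R) :
  1 <= q -> 1 <= k -> 0 < eps -> eps < 1 ->
  1 <= log2 (4 * k / eps) /\ ln (q * (1 + k)) <= (q + 1) * log2 (4 * k / eps).
Proof.
move=> q1 k1 eps0 eps1.
have lnle (x y : R) : 0 < x -> x <= y -> ln x <= ln y.
  move=> x0; rewrite le_eqVlt => /predU1P[->|xy] //.
  by apply/ltW/RltP/ln_increasing; apply/RltP.
have expln (x : R) : 0 < x -> exp (ln x) = x by move=> x0; apply/exp_ln/RltP.
have ln2_gt0 : 0 < ln 2.
  by rewrite ltNge; apply/negP => /ler_expR; rewrite expln // expR0; lra.
have ln2_le1 : ln 2 <= 1.
  by have := expR_ge1Dx (ln 2); rewrite expln //; lra.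
have lnq : ln q <= q - 1.
  by have := expR_ge1Dx (ln q); rewrite expln; lra.
have le_arg : 4 * k <= 4 * k / eps.
  by rewrite ler_pdivlMr // ler_piMr //; lra.
have log2E : log2 (4 * k / eps) * ln 2 = ln (4 * k / eps).
  by rewrite /log2 RdivE divfK // gt_eqF.
have ge1 : 1 <= log2 (4 * k / eps).
  rewrite -(@ler_pM2r _ (ln 2)) // log2E mul1r lnle //; lra.
split=> //.
have -> : ln (q * (1 + k)) = ln q + ln (1 + k).
  by apply: ln_mult; apply/RltP; rewrite R0E; lra.
have : ln (1 + k) <= log2 (4 * k / eps) * ln 2 by rewrite log2E lnle //; lra.
have : log2 (4 * k / eps) * ln 2 <= log2 (4 * k / eps) * 1 by rewrite ler_wpM2l //; lra.
have : q * 1 <= q * log2 (4 * k / eps) by rewrite ler_wpM2l //; lra.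
by lra.
Qed.

Lemma affine_csp_sparsifier (F : finFieldType) (eps : R) (k m : nat)
    (Phi : affine_csp F k m) :
  0 < eps -> eps < 1 -> (0 < k)%nat ->
  exists (T : {set 'I_m}) (w : 'I_m -> R),
    is_sparsifier F k m Phi eps T w /\
    #|T|%:R <= (96 * (#|F|%:R + 1) + 2) * (k%:R / eps ^+ 2) * log2 (4 * k%:R / eps).
Proof.
move=> eps0 eps1 k_gt0; pose q : R := #|F|%:R.
have [c cP] := fin_all_exists (fun j =>
  affine_pred_column (vars F k m Phi j) (pr_affine F k m Phi j)).
pose A : 'M[F]_(1 + k, m) := \matrix_(i, j) c j i 0.
have [T [w [w0 wP cardT]]] := code_sparsifier A eps0 eps1 (k_gt0 : (1 < 1 + k)%nat).
exists T, w; split.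
  split=> [j _|x]; first exact: w0.
  pose y := row_mx (1%:M : 'M_1) (\row_v x v).
  have cvalE j : cval F k m Phi j x = (j \in mxsupp A y)%:R.
    rewrite /cval cP mxsupp_row -/y; congr ((_ != 0)%:R).
    by rewrite [LHS]mxE [RHS]mxE; apply: eq_bigr => i _; congr (_ * _); rewrite [RHS]mxE.
  have -> : \sum_j cval F k m Phi j x = #|mxsupp A y|%:R.
    rewrite card_sum1 [RHS]big_mkcond; apply: eq_bigr => j _.
    by rewrite cvalE; case: ifP.
  have -> : \sum_(j in T) w j * cval F k m Phi j x =
      \sum_(j in mxsupp A y) (if j \in T then w j else 0).
    rewrite big_mkcond [RHS]big_mkcond; apply: eq_bigr => j _; rewrite cvalE.
    by case: (j \in mxsupp A y); case: ifP => _; rewrite ?mulr1 ?mulr0.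
  have := wP y; rewrite sumrB -card_sum1 ler_norml => /andP[lo hi].
  by split; lra.
have k1 : 1 <= k%:R :> R by rewrite ler1n.
have q1 : 1 <= q by rewrite ler1n; apply/card_gt0P; exists 0.
have [ell1 ln_le] := ln_code_length_le q1 k1 eps0 eps1.
set ell := log2 _ in ell1 ln_le *.
pose Y := k%:R / eps ^+ 2; rewrite -/Y.
have e2 : 0 < eps ^+ 2 by rewrite exprn_gt0.
have Y1 : 1 <= Y.
  rewrite ler_pdivlMr // mul1r (le_trans _ k1) //.
  by rewrite expr_le1 // ltW.
apply: le_trans cardT _; rewrite natrD.
(* [1 + k <= 2 * k] turns 48 into 96; the additive 2 is absorbed by [1 <= Y * ell]. *)
have : (1 + k%:R) * ln (q * (1 + k%:R)) / eps ^+ 2 <= 2 * Y * ((q + 1) * ell).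
  rewrite mulrAC; apply: (@le_trans _ _ ((1 + k%:R) / eps ^+ 2 * ((q + 1) * ell))).
    by rewrite ler_wpM2l // divr_ge0 ?(ltW e2) // addr_ge0.
  rewrite ler_wpM2r //; first by rewrite mulr_ge0; lra.
  by rewrite /Y mulrA ler_pM2r ?invr_gt0 //; lra.
have : 1 * 1 <= Y * ell by rewrite ler_pM.
by rewrite -/q; lra.
Qed.

Bind Scope R_scope with R.

Theorem theorem1p5 :
  exists c : R,
  forall F : finFieldType,
  exists Cq : R,
  forall (eps : R), 0 < eps -> eps < 1 ->
  forall (k m : nat) (Phi : affine_csp F k m), (0 < k)%nat ->
  exists (T : {set 'I_m}) (w : 'I_m -> R),
    is_sparsifier F k m Phi eps T w /\
    (#|T|%:R <= Cq * (k%:R / eps ^+ 2) * Rpower (log2 (4 * k%:R / eps)) c).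
Proof.
exists 1 => F; exists (96 * (#|F|%:R + 1) + 2) => eps eps0 eps1 k m Phi k_gt0.
have [T [w [sparse cardT]]] := affine_csp_sparsifier Phi eps0 eps1 k_gt0.
exists T, w; split=> //; move: cardT.
have k1 : 1 <= k%:R :> R by rewrite ler1n.
have q1 : 1 <= #|F|%:R :> R by rewrite ler1n; apply/card_gt0P; exists 0.
have [ell1 _] := ln_code_length_le q1 k1 eps0 eps1.
rewrite RdivE RmultE (_ : IZR 4 = 4%:R); last by rewrite -INRE INR_IZR_INZ.
by rewrite Rpower_1 //; apply/RltP; rewrite R0E (lt_le_trans ltr01).
Qed.
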